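(* Let $d\geq 2$ be an integer. Let $m^{\ast}:=\frac{d-1}{4}$ if $d$ is prime and $m^{\ast}:=\frac{d-1}{3}$ otherwise. Let $m$ be an integer with $m>m^{\ast}$ and let $g\in\mathbb{C}^d$ be such that $$\left(\{-m,\dots,m\}\times\mathbb{Z}_d\right)\cup\left(\mathbb{Z}_d\times\{-m,\dots,m\}\right)\subseteq\operatorname{supp}(V_gg).$$ Then $g$ does (STFT) phase retrieval.
   Context: Let $\mathbb{Z}_d:=\mathbb{Z}/d\mathbb{Z}$. An element $f\in\mathbb{C}^d$ is regarded as a function $\mathbb{Z}_d\to\mathbb{C}$, $j\mapsto f_j$, with all indices interpreted modulo $d$. For integers $k_1<k_2$, $\{k_1,\dots,k_2\}$ denotes the subset $\{[j] : k_1\le j\le k_2\}$ of $\mathbb{Z}_d$, where $[j]$ is the class of $j$ modulo $d$. Let $\mathbb{T}:=\{z\in\mathbb{C} : |z|=1\}$. For $f,g\in\mathbb{C}^d$, the short-time Fourier transform (STFT) of $f$ with respect to the window $g$ is $V_gf:\mathbb{Z}_d^2\to\mathbb{C}$, $V_gf(k,l):=\sum_{j=0}^{d-1}f_j\overline{g_{j-k}}e^{-2\pi i jl/d}$. The support of a function $h$ on a finite set $M$ is $\operatorname{supp}(h):=\{x\in M : h(x)\neq 0\}$. A signal $f\in\mathbb{C}^d$ is called phase retrievable w.r.t. $g\in\mathbb{C}^d$ if for every $\tilde f\in\mathbb{C}^d$ with $|V_g\tilde f|=|V_gf|$ (pointwise on $\mathbb{Z}_d^2$) there exists $\gamma\in\mathbb{T}$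 with $\tilde f=\gamma f$. The window $g$ is said to do phase retrieval if every $f\in\mathbb{C}^d$ is phase retrievable w.r.t. $g$. *)

(* Defs.v *)
From mathcomp Require Export all_boot all_order all_algebra.
From mathcomp Require Export complex.
From mathcomp Require Export all_classical all_reals all_analysis.

Set Implicit Arguments.
Unset Strict Implicit.
Unset Printing Implicit Defensive.

Import Order.TTheory GRing.Theory Num.Theory.
Local Open Scope classical_set_scope.
Local Open Scope complex_scope.
Local Open Scope ring_scope.

(* The complex numbers are R[i] for R : realType, and C^d is the space
   {ffun 'Z_d -> R[i]}.  The type 'Z_d is Z/dZ only for d >= 2, which the
   theorem assumes. *)

Section Stft.
Variables (R : realType) (d : nat).
Implicit Types (f g : {ffun 'Z_d -> R[i]}).

(* e^{i t} *)
Definition expi (t : R) : R[i] := cos t +i* sin t.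

(* In the exponent, j and l are coerced to their representatives in
   {0, ..., d-1}; k and j - k live in 'Z_d. *)
Definition stft g f (kl : 'Z_d * 'Z_d) : R[i] :=
  \sum_(j : 'Z_d)
    f j * Num.conj (g (j - kl.1)) *
    expi (- (2 * pi * (nat_of_ord j)%:R * (nat_of_ord kl.2)%:R / d%:R)).

Definition phase_retrievable g f : Prop :=
  forall f' : {ffun 'Z_d -> R[i]},
    (forall kl, `|stft g f' kl| = `|stft g f kl|) ->
    exists2 gamma : R[i], `|gamma| = 1 & forall j, f' j = gamma * f j.

Definition does_phase_retrieval g : Prop := forall f, phase_retrievable g f.

End Stft.

Definition supp (M : finType) (V : nmodType) (h : M -> V) : set M :=
  [set x | h x != 0].

(* {k1, ..., k2} as a subset of Z/dZ *)
Definition Zp_interval (d : nat) (k1 k2 : int) : set 'Z_d :=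
  [set j%:~R | j in [set j : int | k1 <= j <= k2]].
Arguments Zp_interval : clear implicits.

Definition mstar (d : nat) : rat :=
  if prime d then (d%:R - 1) / 4 else (d%:R - 1) / 3.

(* Main.v *)
Require Import Defs.
From mathcomp Require Import zify ring lra.
Import Order.TTheory GRing.Theory Num.Theory.
Local Open Scope ring_scope.

Set Implicit Arguments.
Unset Strict Implicit.
Unset Printing Implicit Defensive.

(** For fixed k, |V_g f(k, .)|^2 is the discrete Fourier transform of the
    autocorrelation of j |-> f_j conj(g_{j-k}).  Since the transform is
    injective and turns cross-correlations into products, the moduli |V_g f|
    determine the product V_f f . conj(V_g g) ([ambiguity_of_norm_stft]), and
    hence V_f f on the support of V_g g.  On the strip {-m..m} x Z_d this gives
    the products f_j conj(f_{j-i}) for |i| <= m, and on the strip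
    Z_d x {-m..m} it gives the analogous products for the transform F of f.

    Knowing u_j conj(u_{j-i}) for |i| <= m fixes the relative phase of any two
    nonzero entries of u at distance at most m.  So u is known up to one global
    phase, unless its support splits into two parts which are more than m
    apart; as the indices are cyclic, there are then two disjoint runs of m
    consecutive zeros ([phase_or_gaps]).  If f or F is known up to a phase, the
    theorem follows.  Otherwise f and F both have such gaps, so that both
    supports have at most d - 2m elements, and an uncertainty principle forces
    f = 0:
    - if 3m >= d, then f has at most m nonzero entries while F vanishes at m
      consecutive points, and a Vandermonde matrix is invertible
      ([uncertainty_gap]);
    - if d is prime and 4m >= d, then F has at least 2m >= d - 2m zeros, and
      all minors of the Fourier matrix of prime order are nonzero by
      Chebotarev's theorem ([chebotarev_uncertainty]).

    The proof of Chebotarev's theorem follows Frenkel.  A singular minor gives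
    exponents e_1, ..., e_n, and a nonzero combination of the x^(e_a) divisible
    by prod_i (x - w^i), with n factors.  The remainders of the x^(e_a) modulo
    prod_i (x - X^i), computed with coefficients in Z[X], form a matrix whose
    determinant D in Z[X] therefore vanishes at w; this implies that p divides
    D(1) ([eval1_modp_eq0]).  Specializing X to 1 in F_p, one obtains a nonzero
    combination of the x^(e_a) over F_p divisible by (x - 1)^n, which is
    impossible: its moments of order less than n vanish, and the e_a are
    distinct modulo p. *)

(** * Chebotarev's theorem *)

(** The Vandermonde matrix of at most n distinct nodes has independent rows: by
    linearity the weights are orthogonal to every polynomial of degree < n, in
    particular to the Lagrange polynomial of each node. *)
Lemma vandermonde_kernel (F : idomainType) (T : finType) (J : {set T})
    (z w : T -> F) (n : nat) :
  {in J &, injective z} -> (#|J| <= n)%N ->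
  (forall k, (k < n)%N -> \sum_(j in J) w j * z j ^+ k = 0) ->
  {in J, forall j, w j = 0}.
Proof.
move=> z_inj leJn mom0 j0 Jj0.
have poly0 (q : {poly F}) : (size q <= n)%N -> \sum_(j in J) w j * q.[z j] = 0.
  move=> szq; under eq_bigr do rewrite (horner_coef_wide _ szq) mulr_sumr.
  rewrite exchange_big big1 //= => k _.
  rewrite -[RHS](mulr0 q`_k) -[X in _ = _ * X](mom0 k (ltn_ord k)) mulr_sumr.
  by apply: eq_bigr => j _; rewrite mulrCA.
pose q := \prod_(j <- enum (J :\ j0)) ('X - (z j)%:P).
have szq : (size q <= n)%N.
  rewrite size_prod_XsubC -cardE; apply: leq_trans leJn.
  by rewrite (cardsD1 j0 J) Jj0.
have qE x : q.[x] = \prod_(j <- enum (J :\ j0)) (x - z j).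
  by rewrite horner_prod; apply: eq_bigr => j _; rewrite hornerXsubC.
have := poly0 q szq; rewrite (bigD1 j0) //= big1 => [|j /andP[Jj jj0]].
  rewrite addr0 => /eqP; rewrite mulf_eq0 => /orP[/eqP //|].
  rewrite qE big_seq prodf_seq_eq0 => /hasP[j].
  rewrite mem_enum !inE => /andP[jj0 Jj] /andP[_].
  by rewrite subr_eq0 => /eqP/(z_inj _ _ Jj0 Jj) eq_j; rewrite eq_j eqxx in jj0.
apply/eqP; rewrite mulf_eq0 qE big_seq prodf_seq_eq0; apply/orP; right.
by apply/hasP; exists j; rewrite ?mem_enum ?inE ?jj0 ?Jj ?subrr ?eqxx.
Qed.

(** Each application of X d/dX lowers the order of vanishing at 1 by at most
    one, and multiplies the coefficient of X^e by e. *)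
Lemma moment0_of_dvdp (F : fieldType) (T : finType) (e : T -> nat) (k n : nat)
    (u : T -> F) :
  (k < n)%N -> ('X - 1%:P) ^+ n %| \sum_i u i *: 'X^(e i) ->
  \sum_i u i * (e i)%:R ^+ k = 0.
Proof.
elim: k n u => [|k IHk] [//|n] u lekn /dvdpP[q Dg].
  transitivity (\sum_i u i *: 'X^(e i)).[1].
    rewrite horner_sum; apply: eq_bigr => i _.
    by rewrite hornerZ hornerXn expr1n expr0.
  by rewrite Dg hornerM horner_exp hornerXsubC subrr expr0n mulr0.
under eq_bigr do rewrite exprS mulrA.
apply: (IHk n) => //.
have -> : \sum_i (u i * (e i)%:R) *: 'X^(e i)
          = 'X * (\sum_i u i *: 'X^(e i))^`() :> {poly F}.
  rewrite linear_sum /= mulr_sumr; apply: eq_bigr => i _.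
  rewrite -scalerA scaler_nat derivZ derivXn -scalerAr mulrnAr; congr (_ *: _).
  by case: (e i) => [|m] /=; rewrite ?mulr0n // exprS.
rewrite Dg derivM deriv_exp dvdp_mull //; apply: dvdp_add.
  by rewrite dvdp_mull // exprS dvdp_mull.
by rewrite dvdp_mull // -mulr_natr dvdp_mulr // dvdp_mull.
Qed.

(** D has a nonconstant common factor with X^p - 1 over Z, since their resultant
    vanishes.  Modulo p this factor divides (X - 1)^p, so it vanishes at 1. *)
Lemma eval1_modp_eq0 (K : numFieldType) (p : nat) (w : K) (D : {poly int}) :
  prime p -> w ^+ p = 1 -> (map_poly intr D).[w] = 0 ->
  (map_poly intr D).[1] = 0 :> 'F_p.
Proof.
move=> p_pr wp1 Dw0.
have p_gt0 := prime_gt0 p_pr.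
pose E : {poly int} := 'X^p - 1.
have szE : size E = p.+1 by rewrite size_XnsubC.
have szE1 : (1 < size E)%N by rewrite szE ltnS.
have Ew0 : (map_poly intr E).[w] = 0 :> K.
  by rewrite rmorphB rmorph1 /= map_polyXn !hornerE wp1 subrr.
have [szD|szD] := leqP (size D) 1.
  have DC := size1_polyC szD; move: Dw0; rewrite DC !map_polyC !hornerC /=.
  by move=> /eqP; rewrite intr_eq0 => /eqP->.
have res0 : resultant D E = 0.
  have [uv _ Dr] := resultant_in_ideal szD szE1.
  have := congr1 (fun q : {poly int} => (map_poly (intr : int -> K) q).[w]) Dr.
  rewrite rmorphD !rmorphM /= !hornerE Dw0 Ew0 !mulr0 addr0 map_polyC hornerC /=.
  by move=> /eqP; rewrite intr_eq0 => /eqP.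
move/eqP: res0; rewrite resultant_eq0; set h0 := Pdiv.Idomain.gcdp D E => szh.
have [r1 Dr1] := dvdpP_int (Pdiv.Idomain.dvdp_gcdl D E).
have [r2 Er2] := dvdpP_int (Pdiv.Idomain.dvdp_gcdr D E).
rewrite -/h0 in Dr1 Er2; pose h := zprimitive h0; rewrite -/h in Dr1 Er2.
have szh1 : (1 < size h)%N by rewrite size_zprimitive.
(* h divides a monic polynomial, hence its reduction mod p keeps its degree. *)
have lh : lead_coef h \is a GRing.unit.
  have : lead_coef h * lead_coef r2 = 1.
    by rewrite -lead_coefM -Er2 lead_coefXnsubC.
  by move=> lr; apply/unitrPr; exists (lead_coef r2).
pose mp := map_poly (intr : int -> 'F_p).
have szmh : (1 < size (mp h))%N.
  rewrite size_poly_eq //.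
  have : (lead_coef h)%:~R \is a @GRing.unit 'F_p by apply: rmorph_unit.
  by rewrite unitfE.
suff: root (mp h) 1 by rewrite Dr1 rmorphM hornerM => /eqP->; rewrite mul0r.
have dvdh : mp h %| ('X - 1%:P) ^+ p.
  apply/dvdpP; exists (mp r2); rewrite mulrC -[mp h * _]rmorphM -Er2.
  have pF : p \in [pchar {poly 'F_p}] by rewrite pchar_poly pchar_Fp.
  rewrite -(pFrobenius_autE pF) pFrobenius_autB_comm; last exact: mulrC.
  by rewrite !pFrobenius_autE -polyC_exp expr1n /mp rmorphB !rmorph1 /= map_polyXn.
apply: contraLR szmh; rewrite -coprimep_XsubC => cop.
have : mp h %| 1.
  rewrite -(Gauss_dvdpr _ (_ : coprimep (mp h) (('X - 1%:P) ^+ p))) ?mulr1 //.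
  by rewrite coprimep_expr // coprimep_sym.
by rewrite dvdp1 => /eqP->.
Qed.

(** The matrix H of the coefficients of the remainders of the X^(e a) modulo W
    represents divisibility by W after any specialization of the scalars,
    because Euclidean division by a monic polynomial commutes with ring
    morphisms. *)
Lemma remainder_matrix (A : comNzRingType) (n : nat) (W : {poly A})
    (e : 'I_n -> nat) :
  W \is monic -> size W = n.+1 ->
  exists H : 'M[A]_n, forall (F : fieldType) (phi : {rmorphism A -> F})
      (u : 'rV[F]_n),
    u *m map_mx phi H = 0 <->
    map_poly phi W %| \sum_a u 0 a *: 'X^(e a).
Proof.
move=> monW szW; pose r a := Pdiv.Ring.rmodp 'X^(e a) W.
have szr a : (size (r a) <= n)%N.
  by rewrite -ltnS -szW Pdiv.Ring.ltn_rmodp monic_neq0.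
exists (\matrix_(a, k) (r a)`_k) => F phi u.
set H := map_mx _ _; set P := \sum_a _; pose W' := map_poly phi W.
pose rem := \sum_a u 0 a *: map_poly phi (r a).
have szW' : size W' = n.+1.
  by rewrite size_map_poly_id0 // (monicP monW) rmorph1 oner_eq0.
have dvdW' : (W' %| P) = (W' %| rem).
  have -> : P = \sum_a u 0 a *: map_poly phi (Pdiv.Ring.rdivp 'X^(e a) W) * W'
                + rem.
    rewrite -big_split; apply: eq_bigr => a _ /=.
    rewrite -scalerAl -scalerDr -rmorphM -rmorphD /=.
    by rewrite -Pdiv.RingMonic.rdivp_eq // map_polyXn.
  by rewrite dvdp_addr // -mulr_suml dvdp_mull.
have szrem : (size rem <= n)%N.
  rewrite /rem; apply: (big_ind (fun q : {poly F} => size q <= n)%N).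
  - by rewrite size_poly0.
  - by move=> q1 q2 sz1 sz2; rewrite (leq_trans (size_polyD _ _)) // geq_max sz1.
  move=> a _; apply: leq_trans (size_scale_leq _ _) _.
  by apply: leq_trans (size_poly _ _) (szr a).
have remE (k : 'I_n) : rem`_k = (u *m H) 0 k.
  rewrite coef_sum mxE; apply: eq_bigr => a _.
  by rewrite coefZ coef_map !mxE.
rewrite -/W' dvdW'; split=> [uH0|dvd_rem].
  suff -> : rem = 0 by rewrite dvdp0.
  apply/polyP => k; rewrite coef0; have [ltkn|lenk] := ltnP k n.
    by rewrite (remE (Ordinal ltkn)) uH0 mxE.
  by rewrite nth_default // (leq_trans szrem).
have rem0 : rem = 0.
  apply: contraTeq dvd_rem => /dvdp_leq leW; apply/negP => /leW.
  by rewrite szW' leqNgt ltnS szrem.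
by apply/rowP => k; rewrite -remE rem0 coef0 mxE.
Qed.

Lemma subset_card_exists (T : finType) (A : {set T}) (n : nat) :
  (n <= #|A|)%N -> exists2 B : {set T}, B \subset A & #|B| = n.
Proof.
move=> lenA; exists [set x in take n (enum A)].
  by apply/fintype.subsetP => x; rewrite inE => /mem_take; rewrite mem_enum.
rewrite cardsE (card_uniqP _) ?take_uniq ?enum_uniq //.
by rewrite size_takel // -cardE.
Qed.

(** Uncertainty principle for the Fourier transform of prime order: a vector
    whose transform has at least as many zeros as the vector has nonzero entries
    is zero.  This is Chebotarev's theorem on the minors of the Fourier
    matrix. *)
Lemma chebotarev_uncertainty (K : numFieldType) (p : nat) (w : K)
    (v : 'I_p -> K) (I : {set 'I_p}) :
  prime p -> p.-primitive_root w ->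
  (#|[set j | v j != 0%R]| <= #|I|)%N ->
  (forall i, i \in I -> \sum_j v j * w ^+ (i * j) = 0) ->
  forall j, v j = 0.
Proof.
move=> p_pr w_prim; set J := [set j | v j != 0] => leJI vanish j0.
have [I' sI'I cardI'] := subset_card_exists leJI.
apply/eqP; case: (boolP (v j0 == 0)) => // vj0; exfalso.
have Jj0 : j0 \in J by rewrite inE.
pose n := #|J|; pose e (a : 'I_n) : 'I_p := enum_val a.
pose W : {poly {poly int}} := \prod_(i <- enum I') ('X - ('X^i)%:P).
have szW : size W = n.+1 by rewrite size_prod_XsubC -cardE cardI'.
have monW : W \is monic by rewrite monic_prod_XsubC.
have [H HP] := remainder_matrix (fun a => val (e a)) monW szW.
have inj_natF : {in [set: 'I_n] &, injective (fun a => (val (e a))%:R : 'F_p)}.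
  move=> a b _ _ /(congr1 (fun x : 'F_p => (x : nat))).
  rewrite !val_Fp_nat // !(modn_small (ltn_ord _)) => /val_inj.
  exact: enum_val_inj.
(* The two specializations of X: to w in K, and to 1 in F_p. *)
pose phi : {rmorphism {poly int} -> K} := horner_eval w \o map_poly intr.
pose psi : {rmorphism {poly int} -> 'F_p} := horner_eval 1 \o map_poly intr.
have phiX i : phi 'X^i = w ^+ i.
  by rewrite /phi /= /horner_eval map_polyXn hornerXn.
have psiX i : psi 'X^i = 1.
  by rewrite /psi /= /horner_eval map_polyXn hornerXn expr1n.
have mapW (F : fieldType) (f : {rmorphism {poly int} -> F}) :
    map_poly f W = \prod_(i <- enum I') ('X - (f 'X^i)%:P).
  rewrite rmorph_prod; apply: eq_bigr => i _.
  by rewrite rmorphB /= map_polyX map_polyC.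
have detphi0 : phi (\det H) = 0.
  rewrite -det_map_mx; apply/eqP/det0P.
  exists (\row_a v (e a)).
    apply/eqP => /rowP/(_ (enum_rank_in Jj0 j0)).
    by rewrite !mxE /e enum_rankK_in // => /eqP; rewrite (negPf vj0).
  apply/HP; rewrite mapW; under eq_bigr do rewrite phiX.
  rewrite -(big_map (fun i : 'I_p => w ^+ i) xpredT (fun z => 'X - z%:P)).
  apply: uniq_roots_dvdp.
    apply/allP => _ /mapP[i I'i ->]; apply/rootP.
    rewrite mem_enum in I'i; rewrite -(vanish i (fintype.subsetP sI'I _ I'i)).
    rewrite horner_sum [RHS](bigID (mem J)) /= [X in _ + X]big1 ?addr0; last first.
      by move=> j; rewrite inE negbK => /eqP->; rewrite mul0r.
    rewrite (big_enum_val (fun j => v j * w ^+ (i * j))) /=; apply: eq_bigr => a _.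
    by rewrite hornerZ hornerXn mxE exprM.
  rewrite uniq_rootsE map_inj_in_uniq ?enum_uniq // => i i' _ _ /eqP.
  by rewrite (eq_prim_root_expr w_prim) !modn_small // => /eqP/val_inj.
have : psi (\det H) = 0.
  exact: (eval1_modp_eq0 p_pr (prim_expr_order w_prim) detphi0).
rewrite -det_map_mx => /eqP/det0P[u /eqP u_neq0 /HP].
rewrite mapW; under eq_bigr do rewrite psiX.
rewrite big_enum prodr_const cardI'.
move=> dvdu; apply: u_neq0; apply/rowP => a; rewrite mxE.
apply: (vandermonde_kernel inj_natF (n := n) (w := fun b => u 0 b)) => //.
  by rewrite cardsT card_ord.
move=> k ltkn; under eq_bigl do rewrite inE.
exact: moment0_of_dvdp ltkn dvdu.
Qed.

(** * Phase propagation on Z/dZ *)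

Lemma ltn_Zp (d : nat) (i : 'Z_d) : (1 < d)%N -> (i < d)%N.
Proof. by case: d i => [|[|d]] i // _; apply: ltn_ord. Qed.

(** If b is not within m steps after any element of G, then the last element of
    G before b (in cyclic order) is followed by m elements outside G. *)
Lemma gap_after (d m : nat) (G : {set 'Z_d}) (b : 'Z_d) :
  (1 < d)%N -> G != finset.set0 ->
  (forall x i, x \in G -> (i <= m)%N -> b != x + i%:R) ->
  (m < d)%N /\
  exists2 x, x \in G & forall i, (0 < i <= m)%N -> x + i%:R \notin G.
Proof.
move=> hd /set0Pn[x0 Gx0] far.
have bE x : b = x + (nat_of_ord (b - x))%:R by rewrite natr_Zp addrC subrK.
have dist_gt x : x \in G -> (m < (b - x)%R)%N.
  by move=> Gx; rewrite ltnNge; apply/negP => /(far x _ Gx); rewrite -bE eqxx.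
split.
  apply: ltn_trans (dist_gt _ Gx0) _.
  exact: ltn_Zp.
case: (arg_minnP (fun x : 'Z_d => nat_of_ord (b - x)) Gx0) => x Gx min_x.
exists x => // i /andP[i_gt0 leim]; apply/negP => Gxi.
have lei : (i <= (b - x)%R)%N by apply: leq_trans leim (ltnW (dist_gt x Gx)).
have : nat_of_ord (b - (x + i%:R)) = ((b - x)%R - i)%N.
  rewrite {1}(bE x) addrAC opprD addNKr addrC -natrB // val_Zp_nat //.
  rewrite modn_small // (leq_ltn_trans (leq_subr _ _)) ?ltn_Zp //.
have := min_x _ Gxi => le_min eq_i; move: le_min; rewrite eq_i.
by rewrite leqNgt -{2}[nat_of_ord (b - x)]subn0 ltn_sub2l // (leq_trans i_gt0).
Qed.

Lemma card_translates (d m : nat) (x : 'Z_d) :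
  (1 < d)%N -> (m < d)%N -> #|[set x + (i : 'I_m).+1%:R | i : 'I_m]| = m.
Proof.
move=> hd ltmd; rewrite card_imset ?card_ord // => i j /addrI.
move=> /(congr1 (fun y : 'Z_d => nat_of_ord y)).
rewrite !val_Zp_nat // !modn_small ?(leq_ltn_trans _ ltmd) ?ltn_ord //.
by case=> /val_inj.
Qed.

Lemma phase_propagate (C : numClosedFieldType) (c s t s' t' : C) :
  `|c| = 1 -> t != 0 -> t' = c * t ->
  s * Num.conj t = s' * Num.conj t' -> s' = c * s.
Proof.
move=> c1 t0 -> eq_st; have cc : c * Num.conj c = 1 by rewrite -normCK c1 expr1n.
apply: (mulIf (_ : Num.conj t != 0)); first by rewrite conjC_eq0.
by rewrite -mulrA eq_st rmorphM /= mulrCA [c * _]mulrA cc mul1r.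
Qed.

(** The products of entries at distance at most m determine u up to a phase,
    unless u vanishes at m consecutive points and in at least 2m places. *)
Lemma phase_or_gaps (C : numClosedFieldType) (d m : nat) (u u' : 'Z_d -> C) :
  (1 < d)%N ->
  (forall a i, (i <= m)%N ->
     u a * Num.conj (u (a - i%:R)) = u' a * Num.conj (u' (a - i%:R))) ->
  (exists2 c : C, `|c| = 1 & forall j, u' j = c * u j) \/
  (exists (x : 'Z_d) (I : {set 'Z_d}),
     [/\ forall i, (0 < i <= m)%N -> u (x + i%:R) = 0,
         (m.*2 <= #|I|)%N & {in I, forall j, u j = 0}]).
Proof.
move=> hd corr_eq.
have normE a : `|u a| = `|u' a|.
  have := corr_eq a 0 (leq0n m); rewrite subr0 -!normCK => /eqP.
  by rewrite eqrXn2 // => /eqP.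
case: (pickP (fun a => u a != 0)) => [a0 ua0|u0]; last first.
  left; exists 1; first exact: normr1.
  move=> j; have /negbFE/eqP uj0 := u0 j; apply/eqP.
  by rewrite uj0 mulr0 -normr_eq0 -normE uj0 normr0.
pose c := u' a0 / u a0.
have c1 : `|c| = 1 by rewrite normf_div -normE divff // normr_eq0.
(* G and B split the support of u according to whether u' = c u; by phase
   propagation, no point of G is within distance m of a point of B. *)
pose G := [set a | (u a != 0) && (u' a == c * u a)].
pose B := [set a | (u a != 0) && (u' a != c * u a)].
have Ga0 : a0 \in G by rewrite inE ua0 /= divfK.
case: (set_0Vmem B) => [B0|[b Bb]].
  left; exists c => // j; have [uj0|uj0] := eqVneq (u j) 0.
    by apply/eqP; rewrite uj0 mulr0 -normr_eq0 -normE uj0 normr0.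
  have : j \notin B by rewrite B0 inE.
  by rewrite inE uj0 negbK => /eqP.
have farGB x y i : x \in G -> y \in B -> (i <= m)%N -> y != x + i%:R.
  rewrite !inE => /andP[ux /eqP u'x] /andP[_ u'y] leim.
  apply: contraNneq u'y => yE; apply/eqP.
  apply: (phase_propagate c1 ux u'x).
  by have := corr_eq y i leim; rewrite yE addrK.
have farBG x y i : x \in G -> y \in B -> (i <= m)%N -> x != y + i%:R.
  rewrite !inE => /andP[ux /eqP u'x] /andP[_ u'y] leim.
  apply: contraNneq u'y => xE; apply/eqP.
  apply: (phase_propagate c1 ux u'x).
  have := congr1 Num.conj (corr_eq x i leim); rewrite {2 4}xE addrK.
  by rewrite !rmorphM /= !conjCK mulrC => ->; rewrite mulrC.
(* The last point x of G before B is followed by m zeros of u, and so is the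
   last point y of B before G. *)
have nzG : G != finset.set0 by apply/set0Pn; exists a0.
have nzB : B != finset.set0 by apply/set0Pn; exists b.
have [ltmd [x Gx gap_x]] := gap_after hd nzG (fun x i Gx => farGB x b i Gx Bb).
have [_ [y By gap_y]] := gap_after hd nzB (fun x i Bx => farBG a0 x i Ga0 Bx).
have zero z : z \notin G -> z \notin B -> u z = 0.
  by rewrite !inE; case: eqP => //= _ /negbTE->.
have zero_x i : (0 < i <= m)%N -> u (x + i%:R) = 0.
  move=> im; apply: zero (gap_x i im) _; case/andP: im => _ im.
  by apply/negP => Bz; have := farGB x _ i Gx Bz im; rewrite eqxx.
have zero_y i : (0 < i <= m)%N -> u (y + i%:R) = 0.
  move=> im; apply: zero _ (gap_y i im); case/andP: im => _ im.
  by apply/negP => Gz; have := farBG _ y i Gz By im; rewrite eqxx.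
pose Ix := [set x + (i : 'I_m).+1%:R | i : 'I_m].
pose Iy := [set y + (i : 'I_m).+1%:R | i : 'I_m].
right; exists x, (Ix :|: Iy); split=> //; last first.
  move=> z; rewrite inE => /orP[] /imsetP[i _ ->].
    by apply: zero_x; rewrite ltn_ord.
  by apply: zero_y; rewrite ltn_ord.
suff disj : [disjoint Ix & Iy].
  by rewrite cardsU (disjoint_setI0 disj) cards0 subn0 !card_translates // addnn.
rewrite -setI_eq0; apply/eqP/setP => z; rewrite !inE; apply/negP.
case/andP => /imsetP[i _ ->] /imsetP[j _ eq_ij].
have [leij|/ltnW leji] := leqP i j.
  have := farBG x y (j - i)%N Gx By (leq_trans (leq_subr _ _) (ltnW (ltn_ord j))).
  by rewrite -subSS natrB // addrA -eq_ij addrK eqxx.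
have := farGB x y (i - j)%N Gx By (leq_trans (leq_subr _ _) (ltnW (ltn_ord i))).
by rewrite -subSS natrB // addrA eq_ij addrK eqxx.
Qed.

(** * Fourier transform, ambiguity function and uncertainty *)

(** Discrete Fourier transform on Z/dZ at the root of unity w.  Indices in the
    exponent are coerced to their natural number representatives, which is
    harmless when w^d = 1. *)
Definition dft (C : nzRingType) (d : nat) (w : C) (u : 'Z_d -> C) (l : 'Z_d) : C :=
  \sum_j u j * w ^+ (j * l).

(** Cyclic cross-correlation of a and c. *)
Definition cross_corr (C : numClosedFieldType) (d : nat) (a c : 'Z_d -> C)
    (k : 'Z_d) : C :=
  \sum_j a j * Num.conj (c (j - k)).

Lemma expr_Zp_addM (C : nzRingType) (d : nat) (w : C) (a b : 'Z_d) (l : nat) :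
  (1 < d)%N -> w ^+ d = 1 ->
  w ^+ ((a + b)%R * l) = w ^+ (a * l) * w ^+ (b * l).
Proof.
case: d a b => [|[|d]] //= a b _ wd1.
by rewrite -exprD -mulnDl -(expr_mod _ wd1) modnMml (expr_mod _ wd1).
Qed.

Lemma root1_mul_conj (C : numClosedFieldType) (d : nat) (w : C) (k : nat) :
  (0 < d)%N -> w ^+ d = 1 -> w ^+ k * Num.conj (w ^+ k) = 1.
Proof.
move=> d_gt0 wd1; suff w1 : `|w| = 1 by rewrite -normCK normrX w1 !expr1n.
by apply/eqP; rewrite -(@pexpr_eq1 _ _ d) // -normrX wd1 normr1.
Qed.

Lemma dft_cross_corr (C : numClosedFieldType) (d : nat) (w : C)
    (a c : 'Z_d -> C) (q : 'Z_d) :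
  (1 < d)%N -> w ^+ d = 1 ->
  dft w (cross_corr a c) q = dft w a q * Num.conj (dft w c q).
Proof.
move=> hd wd1; rewrite /dft /cross_corr.
under eq_bigr do rewrite mulr_suml.
rewrite exchange_big mulr_suml; apply: eq_bigr => j _ /=.
rewrite (reindex_inj (subrI j)) rmorph_sum mulr_sumr; apply: eq_bigr => s _ /=.
rewrite subKr rmorphM /= -!mulrA; congr (_ * _).
rewrite [RHS]mulrCA; congr (_ * _).
rewrite -[in RHS](subrK s j) expr_Zp_addM // -mulrA.
by rewrite (root1_mul_conj _ (ltnW hd) wd1) mulr1.
Qed.

Lemma dft_inj (C : idomainType) (d : nat) (w : C) (u v : 'Z_d -> C) :
  (1 < d)%N -> d.-primitive_root w -> dft w u =1 dft w v -> u =1 v.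
Proof.
move=> hd w_prim eq_uv j; apply/eqP; rewrite -subr_eq0; apply/eqP.
have ltd (i : 'Z_d) : (i < d)%N by apply: ltn_Zp.
apply: (@vandermonde_kernel _ _ [set: 'Z_d] (fun j : 'Z_d => w ^+ j)
          (fun j => u j - v j) d); last by rewrite inE.
- move=> i k _ _ /eqP; rewrite (eq_prim_root_expr w_prim) !modn_small //.
  by move=> /eqP/val_inj.
- by rewrite cardsT card_ord Zp_cast.
move=> k ltkd; under eq_bigl do rewrite inE.
have := eq_uv k%:R; rewrite /dft val_Zp_nat // modn_small // => /eqP.
rewrite -subr_eq0 -sumrB => /eqP eq0; rewrite -[RHS]eq0.
by apply: eq_bigr => i _; rewrite -exprM mulrBl.
Qed.

Lemma dft_modulate (C : nzRingType) (d : nat) (w : C) (a : 'Z_d -> C)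
    (q t : 'Z_d) :
  (1 < d)%N -> w ^+ d = 1 ->
  dft w (fun j => a j * w ^+ (j * q)) t = dft w a (q + t).
Proof.
move=> hd wd1; apply: eq_bigr => j _.
by rewrite -mulrA [in RHS]mulnC expr_Zp_addM // ![(j * _)%N]mulnC.
Qed.

(** The transform of a nonzero vector with at most m nonzero entries cannot
    vanish at m consecutive points. *)
Lemma uncertainty_gap (C : idomainType) (d m : nat) (w : C) (f : 'Z_d -> C)
    (x : 'Z_d) :
  (1 < d)%N -> d.-primitive_root w -> (#|[set j | f j != 0%R]| <= m)%N ->
  (forall i, (0 < i <= m)%N -> dft w f (x + i%:R) = 0) -> forall j, f j = 0.
Proof.
move=> hd w_prim; set J := [set j | f j != 0] => leJm gap j.
have wd1 := prim_expr_order w_prim.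
have ltd (i : 'Z_d) : (i < d)%N by apply: ltn_Zp.
have dftE l : dft w f l = \sum_(j in J) f j * w ^+ (j * l).
  rewrite /dft (bigID (mem J)) /= [X in _ + X]big1 ?addr0 // => i.
  by rewrite inE negbK => /eqP->; rewrite mul0r.
have w_unit : w \is a GRing.unit.
  by apply/unitrP; exists (w ^+ d.-1); rewrite -exprS -exprSr prednK ?wd1 // ltnW.
(* The gap starts at x + 1 rather than at x. *)
apply/eqP; apply: contraT => fj; pose y := x + 1.
suff : f j * w ^+ (j * y) = 0.
  move/eqP; rewrite mulf_eq0 (negbTE fj) /= => /eqP wy0.
  by have := unitrX (j * y) w_unit; rewrite wy0 unitr0.
apply: (@vandermonde_kernel _ _ J (fun j : 'Z_d => w ^+ j)
          (fun j => f j * w ^+ (j * y)) m); last by rewrite inE.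
- move=> i k _ _ /eqP; rewrite (eq_prim_root_expr w_prim) !modn_small //.
  by move=> /eqP/val_inj.
- exact: leJm.
move=> k ltkm; rewrite -[RHS](gap k.+1 ltkm) dftE.
have -> : x + k.+1%:R = y + k%:R by rewrite mulrS addrA.
apply: eq_bigr => i _; rewrite -mulrA; congr (_ * _).
rewrite [in RHS]mulnC expr_Zp_addM // [in LHS]mulnC; congr (_ * _).
have -> : nat_of_ord (k%:R : 'Z_d) = (k %% d)%N by rewrite val_Zp_nat.
rewrite -exprM mulnC -[LHS](expr_mod _ wd1) -[RHS](expr_mod _ wd1).
by rewrite modnMml.
Qed.

Lemma uncertainty_prime (K : numFieldType) (d : nat) (w : K) (f : 'Z_d -> K)
    (I : {set 'Z_d}) :
  prime d -> d.-primitive_root w -> (#|[set j | f j != 0%R]| <= #|I|)%N ->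
  {in I, forall i, dft w f i = 0} -> forall j, f j = 0.
Proof.
case: d f I => [|[|d]] // f I d_pr w_prim le_supp zero_I.
apply: (chebotarev_uncertainty d_pr w_prim le_supp) => i Ii.
by rewrite -[RHS](zero_I i Ii); apply: eq_bigr => j _; rewrite mulnC.
Qed.

(** Short-time Fourier transform of f with window g, with respect to the
    characters j |-> w^(jl). *)
Definition stftw (C : numClosedFieldType) (d : nat) (w : C) (g f : 'Z_d -> C)
    (k l : 'Z_d) : C :=
  dft w (fun j => f j * Num.conj (g (j - k))) l.

Lemma ambiguity_of_norm_stft (C : numClosedFieldType) (d : nat) (w : C)
    (f f' g : 'Z_d -> C) :
  (1 < d)%N -> d.-primitive_root w ->
  (forall k l, `|stftw w g f' k l| = `|stftw w g f k l|) ->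
  forall k l, stftw w f f k l * Num.conj (stftw w g g k l) =
              stftw w f' f' k l * Num.conj (stftw w g g k l).
Proof.
move=> hd w_prim normE n q; have wd1 := prim_expr_order w_prim.
rewrite /stftw -!dft_cross_corr //; apply: eq_bigr => k _; congr (_ * _).
(* Both sides sum h_j conj(h_{j-n}) conj(g_{j-k}) g_{j-n-k} over j. *)
have corrE (h : 'Z_d -> C) :
    cross_corr (fun j => h j * Num.conj (h (j - n)))
               (fun j => g j * Num.conj (g (j - n))) k =
    cross_corr (fun j => h j * Num.conj (g (j - k)))
               (fun j => h j * Num.conj (g (j - k))) n.
  apply: eq_bigr => j _; rewrite !rmorphM /= !conjCK [j - k - n]addrAC.
  rewrite -!mulrA; congr (_ * _); exact: mulrCA.
rewrite !corrE; apply: (dft_inj hd w_prim) => l.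
rewrite !dft_cross_corr // -!normCK; congr (_ ^+ 2).
exact/esym/normE.
Qed.

(** The retrieval theorem for an arbitrary primitive d-th root of unity in an
    algebraically closed field with conjugation. *)
Lemma stftw_phase_retrieval (C : numClosedFieldType) (d m : nat) (w : C)
    (g f f' : 'Z_d -> C) :
  (1 < d)%N -> d.-primitive_root w ->
  (d <= 3 * m)%N || prime d && (d <= 4 * m)%N ->
  (forall i l, (i <= m)%N -> stftw w g g i%:R l != 0) ->
  (forall k i, (i <= m)%N -> stftw w g g k i%:R != 0) ->
  (forall k l, `|stftw w g f' k l| = `|stftw w g f k l|) ->
  exists2 c : C, `|c| = 1 & forall j, f' j = c * f j.
Proof.
move=> hd w_prim hm g_k g_l normE; have wd1 := prim_expr_order w_prim.
have amb := ambiguity_of_norm_stft hd w_prim normE.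
have amb_eq k l : stftw w g g k l != 0 -> stftw w f f k l = stftw w f' f' k l.
  move=> nz; apply: (mulIf (_ : Num.conj (stftw w g g k l) != 0)) (amb k l).
  by rewrite conjC_eq0.
have corr_f a i : (i <= m)%N ->
    f a * Num.conj (f (a - i%:R)) = f' a * Num.conj (f' (a - i%:R)).
  move=> leim; move: a; apply: (dft_inj hd w_prim) => l.
  exact: amb_eq (g_k i l leim).
(* In its first argument, V_h h(., q) is a cross-correlation, so its transform
   is a product of values of the transform of h. *)
have stft_corr (h : 'Z_d -> C) (q k : 'Z_d) :
    cross_corr (fun j => h j * w ^+ (j * q)) h k = stftw w h h k q.
  by apply: eq_bigr => j _; rewrite mulrAC.
have corr_F a i : (i <= m)%N ->
    dft w f a * Num.conj (dft w f (a - i%:R)) =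
    dft w f' a * Num.conj (dft w f' (a - i%:R)).
  move=> leim; have [b ->] : exists b, a = i%:R + b.
    by exists (a - i%:R); rewrite addrC subrK.
  rewrite [i%:R + b - _]addrAC subrr add0r.
  rewrite -!dft_modulate // -!dft_cross_corr //; apply: eq_bigr => k _.
  by rewrite !stft_corr (amb_eq _ _ (g_l k i leim)).
case: (phase_or_gaps hd corr_f) => // -[_ [I [_ card_I zero_I]]].
case: (phase_or_gaps hd corr_F) => [[c c1 F'E]|[x [I' [gap_x card_I' zero_I']]]].
  exists c => //; apply: (dft_inj hd w_prim) => l; rewrite F'E /dft mulr_sumr.
  by apply: eq_bigr => j _; rewrite mulrA.
suff f0 : forall j, f j = 0.
  exists 1; first exact: normr1.
  move=> j; have /esym := corr_f j 0 (leq0n m).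
  by rewrite subr0 f0 mul0r mulr0 => /eqP; rewrite -normCK expf_eq0 normr_eq0 => /eqP.
have card_supp : (#|[set j | f j != 0%R]| + m.*2 <= d)%N.
  have card_Zd : #|'Z_d| = d by rewrite card_ord Zp_cast.
  rewrite -[X in (_ <= X)%N]card_Zd.
  apply: leq_trans (max_card (mem ([set j | f j != 0%R] :|: I))).
  rewrite cardsU (_ : _ :&: I = finset.set0) ?cards0 ?subn0 ?leq_add2l //.
  apply/setP => j; rewrite !inE; apply/negP => /andP[/negP fj Ij].
  by apply: fj; rewrite zero_I.
case/orP: hm => [le3|/andP[d_pr le4]].
  apply: (uncertainty_gap hd w_prim _ gap_x).
  rewrite -(leq_add2r m.*2) (leq_trans card_supp) // (leq_trans le3) //.
  by rewrite -addnn !mulSn addn0.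
have le_supp : (#|[set j | f j != 0%R]| <= #|I'|)%N.
  apply: leq_trans card_I'.
  rewrite -(leq_add2r m.*2) (leq_trans card_supp) // (leq_trans le4) //.
  by rewrite -addnn !mulSn addn0 !addnA.
exact: (uncertainty_prime d_pr w_prim le_supp zero_I').
Qed.

(** * Complex exponentials and the short-time Fourier transform *)

Local Open Scope complex_scope.

Lemma expiD (R : realType) (s t : R) : expi (s + t) = expi s * expi t.
Proof. by rewrite /expi cosD sinD; simpc; congr (_ +i* _); rewrite addrC. Qed.

Lemma expiMn (R : realType) (t : R) (n : nat) : expi (t *+ n) = expi t ^+ n.
Proof.
elim: n => [|n IHn]; first by rewrite mulr0n /expi cos0 sin0.
by rewrite mulrS exprS expiD IHn.
Qed.

(** The root of unity e^{-2 pi i / d}. *)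
Definition omega (R : realType) (d : nat) : R[i] := expi (- (2 * pi / d%:R)).

Lemma omega_prim (R : realType) (d : nat) :
  (0 < d)%N -> d.-primitive_root (omega R d).
Proof.
move=> d_gt0; have d0 : d%:R != 0 :> R by rewrite pnatr_eq0 -lt0n.
have omegaX k : omega R d ^+ k = expi (- ((pi * k%:R / d%:R) *+ 2)).
  rewrite /omega -expiMn mulNrn; congr (expi (- _)).
  by rewrite -[_ *+ k]mulr_natr -[_ *+ 2]mulr_natl; field.
have omega_exp : omega R d ^+ d = 1.
  by rewrite omegaX mulfK // /expi cosN sinN cos2pi sin2pi oppr0.
rewrite /primitive_root_of_unity d_gt0 /=; apply/forallP => k.
rewrite unity_rootE; have [->|neq_kd] := eqVneq k.+1 d; first by rewrite omega_exp !eqxx.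
apply/eqP/negbTE/eqP; rewrite omegaX => -[cos1 _].
have ltkd : (k.+1 < d)%N by rewrite ltn_neqAle neq_kd ltn_ord.
set x := pi * _ / _ in cos1.
have : 0 < sin x.
  apply: sin_gt0_pi; rewrite /x divr_gt0 ?mulr_gt0 ?pi_gt0 ?ltr0n //=.
  by rewrite ltr_pdivrMr ?ltr0n // ltr_pM2l ?pi_gt0 // ltr_nat.
move: cos1; rewrite cosN mulr2n cosD; have := cos2Dsin2 x; nra.
Qed.

Lemma stft_dft (R : realType) (d : nat) (g f : {ffun 'Z_d -> R[i]})
    (k l : 'Z_d) :
  stft g f (k, l) = stftw (omega R d) g f k l.
Proof.
apply: eq_bigr => j _ /=; rewrite /omega -expiMn; congr (_ * expi _).
rewrite mulNrn; congr (- _); rewrite -[_ *+ (j * l)]mulr_natr natrM.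
ring.
Qed.

Lemma mstar_bound (d : nat) (m : int) :
  (2 <= d)%N -> mstar d < m%:~R ->
  exists2 M : nat, m = M%:Z &
    (d <= 3 * M)%N || prime d && (d <= 4 * M)%N.
Proof.
move=> hd; have d2 : 2 <= d%:R :> rat by rewrite (ler_nat _ 2).
rewrite /mstar; case: m => [M|M] hm; last first.
  have : (Negz M)%:~R < 0 :> rat by rewrite ltrz0.
  by move: hm; case: ifP => _; lra.
exists M => //; rewrite -[_%:~R]/(M%:R) in hm.
case: ifP hm => [d_pr|_] hm; rewrite ?d_pr /=.
  apply/orP; right; rewrite -ltnS -(ltr_nat rat) -addn1 natrD natrM; lra.
rewrite orbF -ltnS -(ltr_nat rat) -addn1 natrD natrM; lra.
Qed.

Unset Implicit Arguments.
Local Open Scope classical_set_scope.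
Local Open Scope complex_scope.
Local Open Scope ring_scope.

Theorem corollary3p2 (R : realType) (d : nat) (hd : (2 <= d)%N)
    (m : int) (hm : mstar d < m%:~R)
    (g : {ffun 'Z_d -> R[i]})
    (hg : (Zp_interval d (- m) m `*` [set: 'Z_d]) `|`
          ([set: 'Z_d] `*` Zp_interval d (- m) m)
          `<=` supp (stft g g)) :
  does_phase_retrieval g.
Proof.
have [M mE le_dM] := mstar_bound hd hm; subst m.
have interval_nat i : (i <= M)%N -> Zp_interval d (- M%:Z) M%:Z i%:R.
  by move=> leiM; exists i%:Z => //=; rewrite lez_nat leiM andbT; lia.
move=> f f' normE.
apply: (stftw_phase_retrieval (g := g) hd (omega_prim R (ltnW hd)) le_dM).
- move=> i l leiM; rewrite -stft_dft; apply: hg; left.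
  by split=> //; apply: interval_nat.
- move=> k i leiM; rewrite -stft_dft; apply: hg; right.
  by split=> //; apply: interval_nat.
by move=> k l; rewrite -!stft_dft normE.
Qed.
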